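(* Let $p_1,p_2\in\mathcal{P}_d(\mathbb{R})$ and $r\in\mathcal{P}_d([0,\infty))$. Then $d_K(p_1\boxtimes_d r,p_2\boxtimes_d r)\le d_K(p_1,p_2)$.
   Context: $\mathcal{P}_d(K)$: monic degree-$d$ polynomials with all roots in $K$. For $p$ with roots $\lambda_i$, $p(x)=\sum_{k=0}^d(-1)^k\binom{d}{k}\tilde e_k(p)x^{d-k}$ with $\tilde e_k(p)=\binom{d}{k}^{-1}e_k(\lambda_1,\dots,\lambda_d)$; $p\boxtimes_d q$ is defined by $\tilde e_k(p\boxtimes_d q)=\tilde e_k(p)\tilde e_k(q)$. $\mu_p=\frac1d\sum_i\delta_{\lambda_i}$ with CDF $\mathcal{F}_p$. Kolmogorov distance: $d_K(p,q)=\inf\{\epsilon>0:|\mathcal{F}_p(x)-\mathcal{F}_q(x)|\le\epsilon\ \forall x\in\mathbb{R}\}$. *)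

(* Defs.v *)
From HB Require Import structures.
From mathcomp Require Import all_boot all_order all_algebra.
From mathcomp Require Import boolp classical_sets reals.
Set Implicit Arguments. Unset Strict Implicit. Unset Printing Implicit Defensive.
Import Order.TTheory GRing.Theory Num.Theory.
Local Open Scope ring_scope.
Local Open Scope classical_set_scope.

Section Defs.
Variable R : realType.

Definition poly_of_roots (s : seq R) : {poly R} := \prod_(a <- s) ('X - a%:P).

Definition inPd (d : nat) (K : set R) (p : {poly R}) : Prop :=
  exists s : d.-tuple R, (forall a, a \in s -> K a) /\ p = poly_of_roots s.

(* normalized elementary symmetric coefficient: p = sum_k (-1)^k C(d,k) et_k x^(d-k) *)
Definition etil (d : nat) (p : {poly R}) (k : nat) : R :=
  (-1) ^+ k * p`_(d - k) / ('C(d, k))%:R.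

Definition boxtimes (d : nat) (p q : {poly R}) : {poly R} :=
  \sum_(k < d.+1) ((-1) ^+ k * ('C(d, k))%:R * (etil d p k * etil d q k)) *: 'X^(d - k).

(* CDF of the empirical root measure mu_p = (1/d) sum_i delta_{lambda_i};
   meaningful for p in P_d(R) (the root multiset is unique), 0 otherwise *)
Definition cdf (d : nat) (p : {poly R}) (x : R) : R :=
  match pselect (exists s : d.-tuple R, p = poly_of_roots s) with
  | left h => (count (fun a => a <= x) (proj1_sig (cid h)))%:R / d%:R
  | right _ => 0
  end.

Definition dK (d : nat) (p q : {poly R}) : R :=
  inf [set e : R | 0 < e /\ forall x, `|cdf d p x - cdf d q x| <= e].

End Defs.

(* Main.v *)
Require Import Defs.
From HB Require Import structures.
From mathcomp Require Import all_boot all_order all_algebra.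
From mathcomp Require Import boolp classical_sets reals.
From mathcomp Require Import complex.
From mathcomp Require Import topology normedtype realfun trigo.
From mathcomp Require Import zify ring lra.
Import Order.TTheory GRing.Theory Num.Theory.
Import numFieldNormedType.Exports.
Local Open Scope ring_scope.
Set Implicit Arguments. Unset Strict Implicit. Unset Printing Implicit Defensive.

(* Let T p = p [x]_d r. By Laguerre's theorem on polar derivatives, T preserves
   the polynomials without roots in the upper half-plane H. Let q be real-rooted
   and a <= a'. Applying this to complex combinations of (X - a) q and
   (X - a') q shows that P = T ((X - a) q) and Q = T ((X - a') q) satisfy
   Im (Q / P) >= 0 on H. Following the argument of Q / P down a vertical line,
   the number of roots <= x of Q is that of P or one less.

   If the root counts satisfy N_p1 <= N_p2 + k everywhere, move the k smallest
   roots of p1 far to the right, one at a time. Each move lowers N_{T p1} by at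
   most one, and afterwards every sorted root is at least the corresponding root
   of p2, so that further single moves compare the result with T p2. *)

(** * Szego composition and polar derivatives *)

Definition szego_eval (K : fieldType) (n : nat) (f r : {poly K}) (z : K) : K :=
  \sum_(j < n.+1) (-1) ^+ (n - j) * f`_j * r`_j / 'C(n, j)%:R * z ^+ j.

(* Polarising f (viewed in degree n) in one argument at the projective point
   (z : rho); for rho <> 0 this is rho times the polar derivative at z / rho. *)
Definition polar (K : fieldType) (n : nat) (rho z : K) (f : {poly K}) : {poly K} :=
  rho *: f - (n%:R^-1 *: ((rho *: 'X - z%:P) * f^`())).

Lemma coef_polar (K : numFieldType) n (rho z : K) (f : {poly K}) j :
  (polar n.+1 rho z f)`_j =
  (rho * (n.+1%:R - j%:R) * f`_j + z * j.+1%:R * f`_j.+1) / n.+1%:R.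
Proof.
have n0 : n.+1%:R != 0 :> K by rewrite pnatr_eq0.
rewrite /polar coefB !coefZ mulrBl coefB -scalerAl coefZ coefCM coefXM !coef_deriv.
have -> : (if j == 0%N then 0 else f`_j.-1.+1 *+ j.-1.+1) = j%:R * f`_j.
  by case: j => [|j] /=; rewrite ?mul0r // mulr_natl.
rewrite -[_ *+ j.+1]mulr_natl; move: n0.
by move: (n.+1%:R) (j.+1%:R) (j%:R) (f`_j) (f`_j.+1) => a b c e g a0; field.
Qed.

(** The factor [n.+1%:R - j%:R] kills the top coefficient, so polarising lowers the formal degree by
    one. *)
Lemma size_polar (K : numFieldType) n (rho z : K) (f : {poly K}) :
  (size f <= n.+2)%N -> (size (polar n.+1 rho z f) <= n.+1)%N.
Proof.
move=> sf; apply/leq_sizeP => j hj; rewrite coef_polar.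
have -> : f`_j.+1 = 0 by rewrite nth_default // (leq_trans sf).
have [->|ne] := eqVneq j n.+1; first by rewrite subrr !(mulr0, mul0r, addr0).
have -> : f`_j = 0 by rewrite nth_default // (leq_trans sf) // ltn_neqAle eq_sym ne.
by rewrite !(mulr0, mul0r, addr0).
Qed.

(* The point z at which the composition is evaluated also enters the polar
   operator as a constant: this lets the roots of r be removed one by one. *)
Lemma szego_eval_recl (K : numFieldType) n (rho z : K) (f r : {poly K}) :
  (size r <= n.+1)%N ->
  szego_eval n.+1 f (('X - rho%:P) * r) z = szego_eval n (polar n.+1 rho z f) r z.
Proof.
move=> sr.
have n0 : n.+1%:R != 0 :> K by rewrite pnatr_eq0.
have bin0' j : (j <= n)%N -> 'C(n, j)%:R != 0 :> K.
  by move=> h; rewrite pnatr_eq0 -lt0n bin_gt0.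
have binS j : (j <= n)%N -> 'C(n.+1, j.+1)%:R = n.+1%:R * 'C(n, j)%:R / j.+1%:R :> K.
  move=> h; apply: (mulfI (x := j.+1%:R)); first by rewrite pnatr_eq0.
  rewrite mulrCA divff ?pnatr_eq0 // mulr1 -!natrM; congr (_%:R).
  by rewrite -mul_bin_diag.
have binL j : (j <= n)%N -> 'C(n.+1, j)%:R = n.+1%:R * 'C(n, j)%:R / (n.+1%:R - j%:R) :> K.
  move=> h; have nj : n.+1%:R - j%:R != 0 :> K.
    by rewrite -natrB ?pnatr_eq0 -?lt0n ?subn_gt0 //; lia.
  apply: (mulfI nj); rewrite mulrCA divff // mulr1 -natrB ?(leq_trans h) // -!natrM.
  by congr (_%:R); rewrite -mul_bin_down.
rewrite /szego_eval.
under eq_bigr => j _ do rewrite mulrBl coefB coefCM coefXM mulrBr !mulrBl.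
(* ['X * r] contributes nothing at index 0 and [rho * r] nothing at [n.+1]; after a shift both sums
   run over the same indices. *)
rewrite sumrB big_ord_recl /= mulr0 !mul0r add0r.
rewrite [X in _ - X]big_ord_recr /= [r`_n.+1]nth_default // !mulr0 !mul0r addr0 -sumrB.
apply: eq_bigr => j _.
have hj : (j <= n)%N by rewrite -ltnS.
rewrite coef_polar /bump /= add1n subSS binS // binL // subSn // !exprS.
have nj : n.+1%:R - j%:R != 0 :> K.
  by rewrite -natrB ?pnatr_eq0 -?lt0n ?subn_gt0 //; lia.
have j0 : j.+1%:R != 0 :> K by rewrite pnatr_eq0.
have b0 := bin0' _ hj.
move: nj j0 b0 n0; move: (n.+1%:R) (j.+1%:R) ('C(n, j)%:R) (j%:R : K) => a b c e nj j0 b0 n0.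
by field; rewrite b0 n0 nj j0.
Qed.

(** * Laguerre's theorem on the upper half-plane *)

Section UpperHalfPlane.
Variable R : rcfType.
Implicit Types (x y z : R[i]) (f g : {poly R[i]}).
Local Notation Im := (@complex.Im R).

(* The Moebius image of the lower half-plane under l |-> (z - rho l) / (x - l)
   is a disc missing 0, so it lies in an open half-plane through 0. *)
Lemma polar_term_Im (rho : R) x z (l : R[i]) :
  0 <= rho -> 0 < Im x -> 0 < Im z -> Im l <= 0 ->
  Im ((conjc z - rho%:C%C * x) * (rho%:C%C + (z - rho%:C%C * x) / (x - l))) < 0.
Proof.
case: x z l => x1 x2 [z1 z2] [l1 l2] /= r0 x0 z0 l0.
set D := (_ ^+ 2 + _); have D0 : 0 < D.
  by rewrite /D ltr_wpDl ?sqr_ge0 // exprn_gt0 //; lra.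
have DE : D = (x1 - l1) ^+ 2 + (x2 - l2) ^+ 2 by [].
rewrite -(pmulr_llt0 _ D0).
set A := (X in X < 0).
have -> : A = - ((x2 - l2) * ((z1 - rho * x1) ^+ 2 + z2 ^+ 2 - rho ^+ 2 * x2 ^+ 2)
  + 2 * (z1 - rho * x1) * rho * x2 * (x1 - l1)
  + rho * ((x1 - l1) ^+ 2 + (x2 - l2) ^+ 2) * (z2 + rho * x2)).
  by rewrite /A DE; field; rewrite -DE gt_eqF.
rewrite oppr_lt0.
set u := z1 - rho * x1; set w := x1 - l1; set v := x2 - l2.
have vx : x2 <= v by rewrite /v; lra.
(* Since [v - x2 = - l2], no summand on the right is negative, and the first is positive. *)
have -> : v * (u ^+ 2 + z2 ^+ 2 - rho ^+ 2 * x2 ^+ 2) + 2 * u * rho * x2 * w +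
  rho * (w ^+ 2 + v ^+ 2) * (z2 + rho * x2) =
  v * z2 ^+ 2 + (v - x2) * u ^+ 2 + x2 * (u + rho * w) ^+ 2
  + rho * (w ^+ 2 + v ^+ 2) * z2 + rho ^+ 2 * x2 * v * (v - x2) by ring.
have h1 : 0 < v * z2 ^+ 2 by rewrite mulr_gt0 ?exprn_gt0 //; lra.
have h2 : 0 <= (v - x2) * u ^+ 2 by rewrite mulr_ge0 ?sqr_ge0 //; lra.
have h3 : 0 <= x2 * (u + rho * w) ^+ 2 by rewrite mulr_ge0 ?sqr_ge0 //; lra.
have h4 : 0 <= rho * (w ^+ 2 + v ^+ 2) * z2.
  by rewrite !mulr_ge0 ?addr_ge0 ?sqr_ge0 //; lra.
have h5 : 0 <= rho ^+ 2 * x2 * v * (v - x2) by rewrite !mulr_ge0 ?sqr_ge0 //; lra.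
lra.
Qed.

(** The exact degree is part of the condition because polarisation depends on [n]: a drop in degree
    would be a root at infinity. *)
Definition stable (n : nat) f : Prop :=
  size f = n.+1 /\ forall z, 0 < Im z -> f.[z] != 0.

Lemma stable_split n f : stable n f ->
  exists2 s : n.-tuple R[i], (forall l, l \in s -> Im l <= 0) &
    f = lead_coef f *: \prod_(l <- s) ('X - l%:P).
Proof.
move=> [sf nz]; have [s fE] := closed_field_poly_normal f.
have f0 : lead_coef f != 0 by rewrite lead_coef_eq0 -size_poly_eq0 sf.
have ss : size s == n.
  by move: sf; rewrite fE size_scale // size_prod_XsubC => -[->].
exists (Tuple ss) => //= l ls; rewrite leNgt; apply/negP => /nz.
by rewrite fE hornerZ mulf_eq0 negb_or -!rootE root_prod_XsubC ls andbF.
Qed.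

Lemma deriv_prod_XsubC_horner (s : seq R[i]) x :
  x \notin s -> (\prod_(l <- s) ('X - l%:P))^`().[x] =
  (\prod_(l <- s) ('X - l%:P)).[x] * \sum_(l <- s) (x - l)^-1.
Proof.
elim: s => [|l s IH]; first by rewrite !big_nil derivE hornerC mulr0.
rewrite inE negb_or => /andP[xl xs].
rewrite !big_cons derivM derivB derivX derivC subr0 mul1r hornerD !hornerM IH //.
have : x - l != 0 by rewrite subr_eq0.
by rewrite hornerXsubC => ?; field.
Qed.

Lemma sum_Im_lt0 (s : seq R[i]) (F : R[i] -> R[i]) : s != [::] ->
  (forall l, l \in s -> Im (F l) < 0) -> Im (\sum_(l <- s) F l) < 0.
Proof.
have ImD a b : Im (a + b) = Im a + Im b by case: a b => ? ? [].
case: s => // a s _ h; rewrite big_cons ImD.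
rewrite ltr_wnDr ?h ?mem_head //.
have {h} : forall l, l \in s -> Im (F l) < 0 by move=> l ls; rewrite h // inE ls orbT.
elim: s => [|b s IH] h; first by rewrite big_nil.
rewrite big_cons ImD; have := h b (mem_head _ _).
have : Im (\sum_(l <- s) F l) <= 0 by apply: IH => l ls; rewrite h // inE ls orbT.
lra.
Qed.

(** At [x], the polarisation is [f.[x]] times the mean of [rho + (z - rho x) / (x - l)] over the
    roots [l]. By [polar_term_Im] all these terms lie in one open half-plane, so their sum is
    nonzero. *)
Lemma stable_polar n f (rho : R) z : 0 <= rho -> 0 < Im z ->
  stable n.+1 f -> stable n (polar n.+1 rho%:C%C z f).
Proof.
move=> r0 z0 stf; have [s sl fE] := stable_split stf.
case: stf => sf nz.
have c0 : lead_coef f != 0 by rewrite lead_coef_eq0 -size_poly_eq0 sf.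
have n0 : n.+1%:R != 0 :> R[i] by rewrite pnatr_eq0.
have s0 : (s : seq _) != [::] by rewrite -size_eq0 size_tuple.
split.
  apply/eqP; rewrite eqn_leq size_polar ?sf //=.
  (* If the degree fell below [n], the coefficient at [n] would vanish. It is a nonzero multiple of
     the sum of [rho * l - z], whose terms all have negative imaginary part. *)
  rewrite ltnNge; apply/negP => /leq_sizeP/(_ n (leqnn n))/eqP.
  rewrite coef_polar mulf_eq0 invr_eq0 (negPf n0) orbF.
  have fn : f`_n.+1 = lead_coef f by rewrite /lead_coef sf.
  have -> : f`_n = - lead_coef f * \sum_(l <- s) l.
    rewrite [in LHS]fE coefZ; have := @coefPn_prod_XsubC _ s.
    by rewrite size_tuple /= => ->; rewrite ?mulrN ?mulNr.
  rewrite fn -natr1 addrAC subrr add0r mulr1.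
  have -> : rho%:C%C * (- lead_coef f * \sum_(l <- s) l) + z * (n%:R + 1) * lead_coef f
   = - lead_coef f * \sum_(l <- s) (rho%:C%C * l - z).
    rewrite sumrB -mulr_sumr big_const_seq count_predT size_tuple iter_addr_0.
    by rewrite mulrSr -mulr_natr; ring.
  rewrite mulf_eq0 oppr_eq0 (negPf c0) /= => /eqP h.
  have : Im (\sum_(l <- s) (rho%:C%C * l - z)) < 0.
    apply: sum_Im_lt0 => // l /sl; case: {h} l => l1 l2 /=; case: z z0 => z1 z2 /= z0 l0.
    nra.
  by rewrite h /= ltxx.
move=> x x0; apply/negP => /eqP h.
have xs : x \notin s by apply/negP => /sl; rewrite leNgt x0.
have fx := nz x x0.
have fx' : f^`().[x] = f.[x] * \sum_(l <- s) (x - l)^-1.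
  by rewrite fE derivZ !hornerZ deriv_prod_XsubC_horner // mulrA.
have {}h : \sum_(l <- s) (rho%:C%C + (z - rho%:C%C * x) / (x - l)) = 0.
  rewrite big_split /= -mulr_sumr big_const_seq count_predT size_tuple iter_addr_0.
  apply: (mulfI fx); rewrite mulr0.
  transitivity (n.+1%:R * (polar n.+1 rho%:C%C z f).[x]); last by rewrite h mulr0.
  rewrite /polar.
  rewrite hornerD hornerN !hornerZ hornerM hornerD hornerN hornerZ hornerX hornerC fx'.
  rewrite -[_ *+ _]mulr_natl; move: n0; move: (n.+1%:R) (\sum_(l <- s) _) => a b a0.
  by field.
have : Im (\sum_(l <- s) ((conjc z - rho%:C%C * x) * (rho%:C%C + (z - rho%:C%C * x) / (x - l)))) < 0.
  by apply: sum_Im_lt0 => // l /sl; apply: polar_term_Im.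
by rewrite -mulr_sumr h mulr0 ltxx.
Qed.

(** Each entry of [s] is traded for a polarisation of [f], which stays stable, until a nonzero
    constant is left. *)
Lemma szego_eval_neq0 n f (s : n.-tuple R) z :
  (forall a, a \in s -> 0 <= a) -> stable n f -> 0 < Im z ->
  szego_eval n f (\prod_(a <- s) ('X - (a%:C%C)%:P)) z != 0.
Proof.
elim: n f s => [|n IH] f s s0 stf z0.
  rewrite (tuple0 s) /szego_eval big_ord1 big_nil /= !(expr0, mul1r, mulr1, invr1, coefC) /= ?mulr1.
  by case: stf => sf _; rewrite -[0%N]/(1%N.-1) -sf -lead_coefE lead_coef_eq0 -size_poly_eq0 sf.
case/tupleP: s s0 => a s s0; rewrite /= big_cons szego_eval_recl; last first.
  by rewrite size_prod_XsubC size_tuple.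
apply: IH => //; first by move=> b bs; rewrite s0 // inE bs orbT.
by apply: stable_polar => //; rewrite s0 // mem_head.
Qed.

End UpperHalfPlane.

(** * A continuous argument built from arctangents *)

Section ArctanSums.
Variable R : realType.
Implicit Types (s : R) (c : seq R).

Lemma prod_1Dit_polar c : exists2 rho : R, 0 < rho &
  \prod_(t <- c) (1 +i* t)%C =
  (rho * cos (\sum_(t <- c) atan t) +i* (rho * sin (\sum_(t <- c) atan t)))%C.
Proof.
elim: c => [|t c [rho rho0 IH]].
  by exists 1 => //; rewrite !big_nil cos0 sin0 mulr1 mulr0.
have q0 : 0 < Num.sqrt (1 + t ^+ 2) by rewrite sqrtr_gt0 ltr_pwDl ?sqr_ge0.
exists (Num.sqrt (1 + t ^+ 2) * rho); first exact: mulr_gt0.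
have ct : cos (atan t) = (Num.sqrt (1 + t ^+ 2))^-1 by rewrite cos_atan.
have st : sin (atan t) = t / Num.sqrt (1 + t ^+ 2).
  rewrite -ct; apply: (divIf (y := cos (atan t))).
    by rewrite ct invr_eq0 gt_eqF.
  by rewrite mulfK ?ct ?invr_eq0 ?gt_eqF // -{3}[t]atanK /tan ct.
rewrite !big_cons IH sinD cosD ct st; apply/eqP; rewrite eq_complex /=.
by apply/andP; split; apply/eqP; field; rewrite gt_eqF.
Qed.

(** The argument of the product of [1 + i s t] over [t] in [c], not reduced modulo [2 pi], hence
    continuous in [s]. *)
Definition atan_sum c s : R := \sum_(t <- c) atan (s * t).

Lemma continuous_atan_sum c : continuous (atan_sum c).
Proof.
rewrite /atan_sum => s; elim: c => [|t c IH].
  by under eq_fun do rewrite big_nil; exact: cst_continuous.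
under eq_fun do rewrite big_cons.
apply: cvgD; last by rewrite ?big_cons; exact: IH.
exact: (cvg_comp _ _ (@mulrr_continuous R t s) (@continuous_atan R (s * t))).
Qed.

Lemma atan_sum0 c : atan_sum c 0 = 0.
Proof. by rewrite /atan_sum big1 // => t _; rewrite mul0r atan0. Qed.

Lemma cvgy_atan_sum c : 0 \notin c ->
  (atan_sum c s @[s --> +oo] --> (\sum_(t <- c) Num.sg t) * (pi / 2))%classic.
Proof.
rewrite /atan_sum; elim: c => [|t c IH] c0.
  under eq_fun do rewrite big_nil; rewrite big_nil mul0r; exact: cvg_cst.
move: c0; rewrite inE eq_sym negb_or => /andP[t0 /IH {}IH].
under eq_fun do rewrite big_cons; rewrite big_cons mulrDl.
apply: cvgD => //.
have pos (u : R) : 0 < u -> (atan (s * u) @[s --> +oo] --> (pi / 2 : R))%classic.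
  move=> u0; exact: (cvg_comp _ _ (gt0_cvgMly u0 cvg_id) (@cvgy_atan R)).
have [tn|tp|tz] := ltgtP t 0; last by rewrite tz eqxx in t0.
- rewrite ltr0_sg // mulN1r.
  have -> : (fun s => atan (s * t)) = (fun s => - atan (s * - t)).
    by apply/funext => s; rewrite mulrN atanN opprK.
  by apply: cvgN; apply: pos; rewrite oppr_gt0.
- by rewrite gtr0_sg // mul1r; apply: pos.
Qed.

(** A continuous function starting at 0 cannot leave [[0, pi]] without taking a value whose sine is
    negative. *)
Lemma atan_sum_range c : (forall s, 0 < s -> 0 <= sin (atan_sum c s)) ->
  forall s, 0 < s -> 0 <= atan_sum c s <= pi.
Proof.
move=> h s s0; have p0 := pi_gt0 R.
(* The value 0 is excluded because it may be taken only at parameter 0, where [h] says nothing. *)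
have ivt v : Num.min 0 (atan_sum c s) <= v <= Num.max 0 (atan_sum c s) ->
    v != 0 -> 0 <= sin v.
  move=> hv v0.
  have [t ht tv] : exists2 t, t \in `[0, s] & atan_sum c t = v.
    apply: IVT; rewrite ?(ltW s0) ?atan_sum0 //.
    by apply: continuous_subspaceT => x; exact: continuous_atan_sum.
  rewrite -tv; apply: h; move: ht; rewrite in_itv /= => /andP[t0 _].
  rewrite lt_neqAle t0 andbT; apply: contraNneq v0 => t00.
  by rewrite -tv -t00 atan_sum0.
apply/andP; split; rewrite leNgt; apply/negP => lt0.
(* The truncations give attained values in [[-pi/2, 0)] here and in [(pi, 3pi/2]] in the other case,
   where the sine is negative. *)
- have : 0 <= sin (Num.max (atan_sum c s) (- (pi / 2))).
    apply: ivt; first by rewrite minElt maxElt; do 3! case: ltP => ? //=; lra.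
    by rewrite maxElt; case: ltP => ?; rewrite lt_eqF //; lra.
  rewrite leNgt => /negP; apply; rewrite -oppr_gt0 -sinN; apply: sin_gt0_pi.
  by rewrite maxElt; case: (ltP (atan_sum c s) _) => ?; apply/andP; split; lra.
- have : 0 <= sin (Num.min (atan_sum c s) (pi + pi / 2)).
    apply: ivt; first by rewrite !minElt maxElt; do 3! case: ltP => ? //=; lra.
    by rewrite minElt; case: ltP => ?; rewrite gt_eqF //; lra.
  rewrite leNgt => /negP; apply; rewrite -[Num.min _ _](subrK pi) sinDpi oppr_lt0.
  by apply: sin_gt0_pi; rewrite minElt; case: (ltP (atan_sum c s) _) => ?; apply/andP; split; lra.
Qed.

(** Let [s] tend to infinity in [atan_sum_range]: the limit stays in the closed interval
    [[0, pi]]. *)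
Lemma sum_sg_range c : 0 \notin c ->
  (forall s, 0 < s -> 0 <= sin (atan_sum c s)) ->
  0 <= \sum_(t <- c) Num.sg t <= 2.
Proof.
move=> c0 /atan_sum_range h.
have p2 : 0 < (pi / 2 : R) by rewrite divr_gt0 ?pi_gt0.
have cl : closed (`[0, pi] : set R)%classic by exact: interval_closed.
have : `[0, pi]%classic ((\sum_(t <- c) Num.sg t) * (pi / 2)).
  apply: (@closed_cvg _ _ _ _ _ _ cl _ _ (cvgy_atan_sum c0)).
  near=> s; rewrite /= in_itv /=; apply: h.
  near: s; exact: nbhs_pinfty_gt.
rewrite /= in_itv /= => /andP[].
rewrite pmulr_lge0 // => -> /= le2.
by rewrite -(ler_pM2r p2) [leRHS]mulrC divfK ?pnatr_eq0.
Unshelve. all: by end_near.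
Qed.

End ArctanSums.

(** * Root counts and the CDF *)

Section RootCounting.
Variable R : realType.
Implicit Types (x a : R) (p q r : {poly R}).
Local Notation toC := (map_poly (real_complex R)).
Local Notation cnt s x := (count (fun a => a <= x) s).

Lemma perm_poly_of_roots (s t : seq R) : perm_eq s t -> poly_of_roots s = poly_of_roots t.
Proof. exact: perm_big. Qed.

(** The root tuple that [cdf] picks by choice is a permutation of [s], by unique factorisation. *)
Lemma cdf_poly_of_roots d (s : d.-tuple R) x :
  cdf d (poly_of_roots s) x = (cnt s x)%:R / d%:R.
Proof.
rewrite /cdf; case: pselect => [h|[]]; last by exists s.
congr (_%:R / _); apply/permP.
by rewrite perm_sym; apply: prod_XsubC_eq (proj2_sig (cid h)).
Qed.

Lemma cdf_ge0 d p x : 0 <= cdf d p x.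
Proof. by rewrite /cdf; case: pselect => // h; rewrite divr_ge0. Qed.

Lemma cdf_le1 d p x : cdf d p x <= 1.
Proof.
rewrite /cdf; case: pselect => // h; case: d h => [|d] h; first by rewrite invr0 mulr0.
by rewrite ler_pdivrMr ?ltr0n // mul1r ler_nat (leq_trans (count_size _ _)) // size_tuple.
Qed.

(** Moving slightly to the right of [x] avoids every root without changing a count; the vertical
    line above [y] then ends at no root. *)
Lemma generic_point_gt (s : seq R) x :
  exists2 y, y \notin s & forall t, subseq t s -> cnt t y = cnt t x.
Proof.
have [y xy ys] : exists2 y, x < y & all (fun a => (a <= x) || (y < a)) s.
  elim: s => [|a s [y xy IH]]; first by exists (x + 1) => //; rewrite ltrDl.
  exists (Num.min y (if a <= x then y else (x + a) / 2)).
    by rewrite lt_min xy /=; case: (leP a x) => // xa; rewrite ltr_pdivlMr //; lra.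
  rewrite /=; apply/andP; split.
    by case: (leP a x) => //= xa; rewrite gt_min ltr_pdivrMr //; apply/orP; right; lra.
  apply: sub_all IH => b /orP[->//|yb]; apply/orP; right.
  by rewrite gt_min yb.
exists y.
  by apply/negP => /(allP ys); rewrite ltxx orbF leNgt xy.
move=> t ts; apply: eq_in_count => b bt /=.
have /orP[bx|yb] := allP ys _ (mem_subseq ts bt).
  by rewrite bx (le_trans bx (ltW xy)).
by rewrite !leNgt yb (lt_trans xy yb).
Qed.

Lemma sum_sg_count (s : seq R) x : x \notin s ->
  \sum_(a <- s) Num.sg (x - a) = 2 * (cnt s x)%:R - (size s)%:R.
Proof.
elim: s => [|a s IH]; first by rewrite big_nil /= mulr0 subr0.
rewrite inE negb_or => /andP[xa /IH {}IH].
rewrite big_cons IH /= natrD -[in RHS]natr1.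
case: (ltgtP x a) xa => // h _.
- by rewrite ltr0_sg ?subr_lt0 //=; lra.
- by rewrite gtr0_sg ?subr_gt0 //=; lra.
Qed.

(* Along the vertical line above y, the argument of Q(z) conj(P(z)) is the
   function atan_sum, which starts at 0 and tends to pi times the difference
   of the two root counts. *)
Lemma count_interlace d (al be : d.-tuple R) x :
  (forall z, 0 < complex.Im z ->
     0 <= complex.Im ((toC (poly_of_roots be)).[z] * conjc (toC (poly_of_roots al)).[z])) ->
  (cnt be x <= cnt al x <= (cnt be x).+1)%N.
Proof.
move=> h; have [y ys hy] := generic_point_gt (al ++ be) x.
rewrite -!hy ?prefix_subseq ?suffix_subseq //.
move: ys; rewrite mem_cat negb_or => /andP[yal ybe].
(* With [z = y + i/s], one has [z - b = (i/s) (1 + i s (b - y))] and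
   [conjc (z - a) = (-i/s) (1 + i s (y - a))]. Large [s] brings [z] down to the real axis. *)
pose c := [seq y - a | a <- al] ++ [seq b - y | b <- be].
have c0 : 0 \notin c.
  rewrite mem_cat negb_or; apply/andP; split; apply/mapP => -[a ain] /eqP.
    by rewrite eq_sym subr_eq0 => /eqP ya; rewrite ya ain in yal.
  by rewrite eq_sym subr_eq0 => /eqP ya; rewrite -ya ain in ybe.
have /(sum_sg_range c0) : forall s : R, 0 < s -> 0 <= sin (atan_sum c s).
  move=> s s0; pose z : R[i] := (y +i* s^-1)%C.
  have [rho rho0 rhoE] := prod_1Dit_polar [seq s * t | t <- c].
  have zE : (toC (poly_of_roots be)).[z] * conjc (toC (poly_of_roots al)).[z] =
      ((s ^- 2) ^+ d)%:C%C * \prod_(t <- [seq s * t | t <- c]) (1 +i* t)%C.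
    have -> : ((s ^- 2) ^+ d)%:C%C = (0 +i* s^-1)%C ^+ d * (0 -i* s^-1)%C ^+ d :> R[i].
      rewrite -exprMn rmorphXn; congr (_ ^+ _); apply/eqP.
      by rewrite eq_complex /= !mul0r !mulr0 expr2 invfM addr0 sub0r mulrN opprK !eqxx.
    have prodc (I : d.-tuple R) (k : R[i]) (F G : R -> R[i]) :
        (forall i, F i = k * G i) -> \prod_(i <- I) F i = k ^+ d * \prod_(i <- I) G i.
      move=> FG; under eq_bigr do rewrite FG.
      by rewrite big_split /= big_const_seq count_predT size_tuple iter_mulr mulr1.
    rewrite /poly_of_roots !map_prod_XsubC !horner_prod rmorph_prod /=.
    rewrite (prodc be (0 +i* s^-1)%C _ (fun b => (1 +i* (s * (b - y)))%C)); last first.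
      move=> b; rewrite hornerXsubC; apply/eqP; rewrite eq_complex /=.
      by apply/andP; split; apply/eqP; field; rewrite gt_eqF.
    rewrite (prodc al (0 -i* s^-1)%C _ (fun a => (1 +i* (s * (y - a)))%C)); last first.
      move=> a; rewrite hornerXsubC; apply/eqP; rewrite eq_complex /=.
      by apply/andP; split; apply/eqP; field; rewrite gt_eqF.
    by rewrite big_map big_cat !big_map /= mulrACA [X in _ = _ * X]mulrC.
  have := h z; rewrite zE rhoE big_map /= invr_gt0 => /(_ s0).
  rewrite mul0r addr0 pmulr_rge0 ?exprn_gt0 ?invr_gt0 ?exprn_gt0 //.
  by rewrite pmulr_rge0.
have -> : \sum_(t <- c) Num.sg t = 2 * (cnt al y)%:R - 2 * (cnt be y)%:R.
  rewrite /c big_cat !big_map /= sum_sg_count //.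
  under [X in _ + X]eq_bigr do rewrite -opprB sgrN.
  by rewrite sumrN sum_sg_count // !size_tuple; ring.
rewrite -(ler_nat R (cnt be y)) -(ler_nat R (cnt al y)) -natr1.
by move=> /andP[? ?]; apply/andP; split; lra.
Qed.

(** * The convolution in complex form, and real-rootedness *)

Lemma boxtimesE d p r :
  boxtimes d p r = \poly_(j < d.+1) ((-1) ^+ (d - j) * p`_j * r`_j / 'C(d, j)%:R).
Proof.
rewrite /boxtimes poly_def (reindex_inj rev_ord_inj) /=.
apply: eq_bigr => j _; have jd : (j <= d)%N by rewrite -ltnS.
rewrite subSS /etil (subKn jd) (bin_sub jd); congr (_ *: _).
have : 'C(d, j)%:R != 0 :> R by rewrite pnatr_eq0 -lt0n bin_gt0.
have : ((-1) ^+ (d - j)) ^+ 2 = 1 :> R by exact: sqrr_sign.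
move: ((-1) ^+ (d - j)) ('C(d, j)%:R : R) (p`_j) (r`_j) => e b c f e2 b0.
by rewrite -[in RHS](mulr1 e) -e2; field.
Qed.

Lemma horner_boxtimes d p r (z : R[i]) :
  (toC (boxtimes d p r)).[z] = szego_eval d (toC p) (toC r) z.
Proof.
rewrite boxtimesE /szego_eval.
have -> : toC (\poly_(j < d.+1) ((-1) ^+ (d - j) * p`_j * r`_j / 'C(d, j)%:R)) =
   \poly_(j < d.+1) ((-1) ^+ (d - j) * (toC p)`_j * (toC r)`_j / 'C(d, j)%:R).
  apply/polyP => j; rewrite coef_map coef_poly [RHS]coef_poly; case: ifP => _; last by [].
  by rewrite !coef_map /= !rmorphM fmorphV rmorph_nat rmorphXn rmorphN1.
by rewrite horner_poly.
Qed.

Lemma szego_evalB (K : fieldType) n (b c : K) (f g h : {poly K}) z :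
  szego_eval n (b *: f - c *: g) h z =
  b * szego_eval n f h z - c * szego_eval n g h z.
Proof.
rewrite /szego_eval !mulr_sumr -sumrB; apply: eq_bigr => j _.
by rewrite coefB !coefZ; ring.
Qed.

Lemma map_poly_of_roots (s : seq R) :
  toC (poly_of_roots s) = \prod_(a <- s) ('X - (a%:C%C)%:P).
Proof. by rewrite /poly_of_roots map_prod_XsubC. Qed.

Lemma poly_of_roots_neq0 (s : seq R) (z : R[i]) :
  0 < complex.Im z -> (toC (poly_of_roots s)).[z] != 0.
Proof.
move=> z0; rewrite map_poly_of_roots horner_prod prodf_seq_neq0.
apply/allP => a _ /=; rewrite hornerXsubC subr_eq0; apply/eqP => za.
by rewrite za ltxx in z0.
Qed.

Lemma stable_poly_of_roots d (s : d.-tuple R) : stable d (toC (poly_of_roots s)).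
Proof.
split; last exact: poly_of_roots_neq0.
by rewrite map_poly_of_roots size_prod_XsubC size_tuple.
Qed.

(** Roots of a real polynomial come in conjugate pairs, so none lies in the lower half-plane
    either. *)
Lemma stable_real_rooted d p : p \is monic -> stable d (toC p) ->
  exists s : d.-tuple R, p = poly_of_roots s.
Proof.
move=> mp stp; have [s sl pE] := stable_split stp.
have lc : lead_coef (toC p) = 1 by rewrite lead_coef_map (monicP mp) rmorph1.
rewrite lc scale1r in pE; case: stp => _ nz.
have sr l : l \in s -> ((complex.Re l)%:C)%C = l.
  move=> ls; suff : complex.Im l = 0 by case: l {ls} => ? ? /= ->.
  apply/eqP; rewrite eq_le sl //= leNgt; apply/negP => l0.
  have /nz/negP : 0 < complex.Im (conjc l) by case: l l0 {ls} => ? ? /=; rewrite oppr_gt0.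
  apply; rewrite -rootE -complex_root_conj -map_poly_comp.
  rewrite (eq_map_poly (g := real_complex R)); last by move=> a /=; rewrite oppr0.
  by rewrite pE root_prod_XsubC.
exists [tuple of map (@complex.Re R) s].
apply: (map_poly_inj (real_complex R)); rewrite map_poly_of_roots pE big_map.
by apply: eq_big_seq => l /sr ->.
Qed.

(** * Moving single roots under convolution with [r] *)

Section NonnegativeRoots.
Variables (d : nat) (rho : d.-tuple R).
Hypothesis rho0 : forall a, a \in rho -> 0 <= a.
Local Notation r := (poly_of_roots rho).

Lemma stable_boxtimes p z : stable d (toC p) -> 0 < complex.Im z ->
  (toC (boxtimes d p r)).[z] != 0.
Proof.
by move=> stp z0; rewrite horner_boxtimes map_poly_of_roots szego_eval_neq0.
Qed.

(** This keeps [cdf] of a convolution away from its default value 0. *)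
Lemma boxtimes_real_rooted (s : d.-tuple R) :
  exists t : d.-tuple R, boxtimes d (poly_of_roots s) r = poly_of_roots t.
Proof.
have szM : size (boxtimes d (poly_of_roots s) r) = d.+1 /\
    boxtimes d (poly_of_roots s) r \is monic.
  have c1 : (boxtimes d (poly_of_roots s) r)`_d = 1.
    rewrite boxtimesE coef_poly leqnn subnn expr0 mul1r binn divr1.
    have lc (u : d.-tuple R) : (poly_of_roots u)`_d = 1.
      have := lead_coef_prod_XsubC u xpredT id.
      by rewrite /lead_coef size_prod_XsubC size_tuple.
    by rewrite !lc mulr1.
  have sz : size (boxtimes d (poly_of_roots s) r) = d.+1.
    apply/eqP; rewrite eqn_leq {1}boxtimesE size_poly /= ltnNge; apply/negP.
    by move=> /leq_sizeP/(_ d (leqnn d))/eqP; rewrite c1 oner_eq0.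
  by split => //; rewrite monicE /lead_coef sz c1.
apply: stable_real_rooted; first exact: (proj2 szM).
split; first by rewrite size_map_poly (proj1 szM).
by move=> z; apply: stable_boxtimes; exact: stable_poly_of_roots.
Qed.

Lemma poly_of_roots_cat_cons (u v : seq R) a :
  poly_of_roots (u ++ a :: v) = ('X - a%:P) * poly_of_roots (u ++ v).
Proof.
rewrite -[RHS](big_cons _ _ _ _ xpredT); apply: perm_poly_of_roots.
by rewrite -(cat1s a v) perm_catCA.
Qed.

(* If the imaginary part were negative, the combination of (X - a) q and
   (X - a') q whose image vanishes at z would itself be stable. *)
Lemma boxtimes_Im_ge0 a a' q (z : R[i]) (s : seq R) : a <= a' ->
  (size s).+1 = d -> q = poly_of_roots s -> 0 < complex.Im z ->
  0 <= complex.Im ((toC (boxtimes d (('X - a'%:P) * q) r)).[z] *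
     conjc (toC (boxtimes d (('X - a%:P) * q) r)).[z]).
Proof.
move=> aa' sd -> z0; set q1 := ('X - a'%:P) * _; set q2 := ('X - a%:P) * _.
rewrite !horner_boxtimes leNgt; apply/negP.
set Q := szego_eval _ _ _ _; set P := szego_eval _ _ _ _ => QP.
pose f := Q *: toC q2 - P *: toC q1.
have : szego_eval d f (toC r) z = 0 by rewrite szego_evalB mulrC subrr.
apply/eqP; rewrite map_poly_of_roots szego_eval_neq0 //.
have fE : f = (Q *: ('X - (a%:C%C)%:P) - P *: ('X - (a'%:C%C)%:P)) * toC (poly_of_roots s).
  rewrite /f /q1 /q2 !rmorphM /= !map_polyXsubC /= -!mul_polyC; ring.
(* If [Q = P], then [Q * conjc P] is real, against [QP]. So the linear factor of [f] keeps degree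
   one. *)
have QP0 : Q - P != 0.
  apply: contraTneq QP => /eqP; rewrite subr_eq0 => /eqP ->.
  by rewrite -leNgt; case: (P) => b c /=; nra.
split.
  have -> : f = (Q - P) *:
      \prod_(l <- (Q * a%:C%C - P * a'%:C%C) / (Q - P) :: map (real_complex R) s) ('X - l%:P).
    rewrite fE big_cons big_map -map_poly_of_roots scalerAl; congr (_ * _).
    rewrite -[in RHS]mul_polyC [in RHS]mulrBr -[in RHS]polyCM [_ * (_ / _)]mulrCA divff // mulr1.
    rewrite -!mul_polyC !polyCB !polyCM; ring.
  by rewrite size_scale // size_prod_XsubC /= size_map sd.
move=> x x0; rewrite fE hornerM mulf_neq0 ?poly_of_roots_neq0 //.
rewrite hornerD hornerN !hornerZ !hornerXsubC subr_eq0; apply/eqP => e.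
(* Imaginary parts give [Im (Q conjc P) |x - a|^2 = |P|^2 (Im x) (a' - a)], whose right side is
   nonnegative. *)
have : (Q * conjc P) * ((x - a%:C%C) * conjc (x - a%:C%C)) =
   (P * conjc P) * ((x - a'%:C%C) * conjc (x - a%:C%C)).
  by rewrite mulrACA e; ring.
move/(congr1 (@complex.Im R)).
case: (Q) QP => Q1 Q2; case: (P) => P1 P2; case: (x) x0 => x1 x2 /= x0 QP.
set T := Q1 * - P2 + Q2 * P1 in QP *.
move=> h; have {h} : T * ((x1 - a) ^+ 2 + x2 ^+ 2) = (P1 ^+ 2 + P2 ^+ 2) * x2 * (a' - a).
  by rewrite -[LHS]addr0; move: h; rewrite /T; lra.
have D0 : 0 < (x1 - a) ^+ 2 + x2 ^+ 2 by rewrite ltr_wpDl ?sqr_ge0 // exprn_gt0.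
have : 0 <= (P1 ^+ 2 + P2 ^+ 2) * x2 * (a' - a).
  by rewrite mulr_ge0 ?subr_ge0 // mulr_ge0 ?(ltW x0) // addr_ge0 ?sqr_ge0.
by move=> h1 h2; move: h1; rewrite -h2 pmulr_lge0 // leNgt QP.
Qed.

Local Notation F s x := (cdf d (boxtimes d (poly_of_roots s) r) x).

Lemma cdf_boxtimes_step (u v : seq R) a a' x : a <= a' -> size (u ++ a :: v) = d ->
  F (u ++ a' :: v) x <= F (u ++ a :: v) x <= F (u ++ a' :: v) x + 1 / d%:R.
Proof.
move=> aa' sd.
have s1 : size (u ++ a :: v) == d by rewrite sd.
have s2 : size (u ++ a' :: v) == d by rewrite -sd !size_cat.
have [al alE] := boxtimes_real_rooted (Tuple s1).
have [be beE] := boxtimes_real_rooted (Tuple s2).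
have : (cnt be x <= cnt al x <= (cnt be x).+1)%N.
  apply: count_interlace => z z0; rewrite -alE -beE /= !poly_of_roots_cat_cons.
  apply: (boxtimes_Im_ge0 (s := u ++ v)) => //.
  by move: sd; rewrite !size_cat /= addnS.
rewrite /= in alE beE; rewrite alE beE !cdf_poly_of_roots -mulrDl natr1.
move=> /andP[h1 h2].
have id0 : 0 <= (d%:R^-1 : R) by rewrite invr_ge0.
by apply/andP; split; apply: ler_wpM2r; rewrite ?ler_nat.
Qed.

(** Roots are raised one at a time; [u] collects those already raised. *)
Lemma cdf_boxtimes_mono (u s t : seq R) x : size (u ++ s) = d -> all2 <=%R s t ->
  F (u ++ t) x <= F (u ++ s) x.
Proof.
elim: s t u => [|a s IH] [|b t] u //= sd /andP[ab st].
have /= := IH t (rcons u b); rewrite !cat_rcons => /(_ _ st) h.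
apply: le_trans (h _) _; first by rewrite -sd !size_cat.
by have /andP[] := cdf_boxtimes_step x ab sd.
Qed.

(** Each root moved to [c] costs at most [1 / d]; [w] collects the copies of [c]. *)
Lemma cdf_boxtimes_shift (u v w : seq R) c x : {in u, forall a, a <= c} ->
  size (w ++ u ++ v) = d ->
  F (w ++ u ++ v) x <= F (w ++ nseq (size u) c ++ v) x + (size u)%:R / d%:R.
Proof.
elim: u w => [|a u IH] w uc sd; first by rewrite mul0r addr0.
have ac : a <= c by rewrite uc ?mem_head.
have /andP[_ /=] := cdf_boxtimes_step x ac sd => /le_trans; apply.
have := IH (rcons w c); rewrite !cat_rcons => /(_ _ _) h.
rewrite -natr1 mulrDl addrA lerD2r /=; apply: h.
  by move=> b bu; rewrite uc // inE bu orbT.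
by rewrite -sd !size_cat /= ?size_cat.
Qed.

End NonnegativeRoots.

(** * From root counts to sorted root lists *)

(** Counting at the head [b] of [t] shows that [s] has an entry, hence its head, at most [b]. For
    the tails, the heads cancel at [x >= b], and below [b] the tail of [t] counts 0. *)
Lemma sorted_all2_le (s t : seq R) : sorted <=%R s -> sorted <=%R t ->
  size s = size t -> (forall x, (cnt t x <= cnt s x)%N) -> all2 <=%R s t.
Proof.
have cnt0 (a x : R) u : path <=%R a u -> x < a -> cnt u x = 0%N.
  move=> /(order_path_min le_trans)/allP h xa; apply/eqP; rewrite -leqn0 leqNgt -has_count.
  apply/hasPn => b /h ab; rewrite -ltNge; exact: lt_le_trans xa ab.
elim: s t => [|a s IH] [|b t] //= sa tb [sz] h.
have ab : a <= b.
  have := h b; rewrite lexx leNgt; apply: contraTN => ba.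
  by rewrite (cnt0 a _ s) // ba.
rewrite ab /= IH ?(path_sorted sa) ?(path_sorted tb) // => x.
have := h x; case: (leP b x) => bx; first by rewrite (le_trans ab bx) !add1n.
by rewrite (cnt0 b).
Qed.

Lemma cdf_boxtimes_le_shift d (rho : d.-tuple R) (s t : seq R) k x :
  (forall a, a \in rho -> 0 <= a) -> size s = d -> size t = d ->
  (forall y, (cnt s y <= cnt t y + k)%N) ->
  cdf d (boxtimes d (poly_of_roots s) (poly_of_roots rho)) x <=
  cdf d (boxtimes d (poly_of_roots t) (poly_of_roots rho)) x + k%:R / d%:R.
Proof.
move=> rho0 sd td h.
have tot : total (<=%R : rel R) by exact: le_total.
(* For [k > d > 0] the added term is at least 1, which bounds any CDF. For [d = 0] the division is
   by zero, but both lists are empty. *)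
have [dk|kd] := ltnP d k.
  have [d0|d0] := posnP d.
    rewrite (_ : s = t) ?lerDl ?divr_ge0 //.
    by rewrite (size0nil (etrans sd d0)) (size0nil (etrans td d0)).
  apply: le_trans (cdf_le1 _ _ _) _.
  have k1 : 1 <= k%:R / d%:R :> R by rewrite ler_pdivlMr ?ltr0n // mul1r ler_nat ltnW.
  by apply: le_trans k1 _; rewrite lerDr cdf_ge0.
(* Bounding [t] as well makes the roots moved to [c] dominate every root of [t]. *)
have [c hc] : exists c : R, {in s ++ t, forall a, a <= c}.
  elim: (s ++ t) => [|a u [c hc]]; first by exists 0.
  exists (Num.max a c) => b; rewrite inE le_max => /predU1P[->|/hc ->]; rewrite ?lexx ?orbT //.
set s' := sort <=%R s; set t' := sort <=%R t.
have ps : perm_eq s' s by rewrite perm_sort.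
have pt : perm_eq t' t by rewrite perm_sort.
rewrite -(perm_poly_of_roots ps) -(perm_poly_of_roots pt).
have sd' : size s' = d by rewrite size_sort.
have td' : size t' = d by rewrite size_sort.
have kt : size (take k s') = k by rewrite size_takel // sd'.
have := @cdf_boxtimes_shift d rho rho0 (take k s') (drop k s') [::] c x.
rewrite /= cat_take_drop kt => /(_ _ sd') /le_trans; apply.
  by move=> a /mem_take; rewrite mem_sort => as_; rewrite hc // mem_cat as_.
rewrite lerD2r.
set q := _ ++ _; rewrite -(perm_poly_of_roots (_ : perm_eq (sort <=%R q) q)) ?perm_sort //.
have sq : size q = d by rewrite size_cat size_nseq size_drop sd' subnKC.
apply: (cdf_boxtimes_mono rho0 (u := [::])) => //.
apply: sorted_all2_le; rewrite ?sort_sorted ?size_sort ?sq //.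
move=> y; rewrite !(permP (permEl (perm_sort _ _))).
rewrite /q count_cat count_nseq.
have [cy|yc] := leP c y.
  rewrite mul1n (leq_trans (leq_add (leqnn _) (count_size _ _))) //.
  rewrite size_drop sd' subnKC //.
  suff -> : cnt t y = d by [].
  rewrite -td; apply/eqP; rewrite -all_count; apply/allP => a ta.
  by rewrite (le_trans _ cy) // hc // mem_cat ta orbT.
rewrite mul0n add0n.
case hb: (has (fun a => a <= y) (drop k s')); last first.
  by move/negbT: hb; rewrite has_count -leqNgt leqn0 => /eqP ->.
have [b bd bY] := hasP hb.
(* A kept root is at most [y], so the [k] smallest are too: [s] counts exactly [k] more than the
   kept roots. *)
rewrite -(leq_add2r k) (leq_trans _ (h y)) // -(permP ps) -[s' in leqRHS](cat_take_drop k).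
rewrite count_cat addnC leq_add2r -{1}kt.
suff -> : cnt (take k s') y = size (take k s') by [].
apply/eqP; rewrite -all_count; apply/allP => a ak.
have : sorted <=%R (take k s' ++ drop k s') by rewrite cat_take_drop sort_sorted.
rewrite sorted_pairwise; last exact: le_trans.
by rewrite pairwise_cat => /and3P[/allrelP/(_ _ _ ak bd) ab _ _]; apply: le_trans ab bY.
Qed.

End RootCounting.

Theorem mainTheorem8 (R : realType) (d : nat) (p1 p2 r : {poly R}) :
  (0 < d)%N ->
  inPd d setT p1 -> inPd d setT p2 -> inPd d [set x : R | 0 <= x] r ->
  dK d (boxtimes d p1 r) (boxtimes d p2 r) <= dK d p1 p2.
Proof.
move=> d0 [s1 [_ ->]] [s2 [_ ->]] [rho [rho0 ->]].
have dR : 0 < d%:R :> R by rewrite ltr0n.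
(* The bound 1 always works, so the set defining the right-hand infimum is nonempty. *)
rewrite /dK; apply: lb_le_inf.
  exists 1; split => // x; rewrite ler_norml.
  have := cdf_ge0 d (poly_of_roots s1) x; have := cdf_le1 d (poly_of_roots s1) x.
  have := cdf_ge0 d (poly_of_roots s2) x; have := cdf_le1 d (poly_of_roots s2) x.
  by move=> *; apply/andP; split; lra.
move=> e [e0 he]; apply: ge_inf; first by exists 0 => ? [/ltW].
split => // x.
have ed0 : 0 <= e * d%:R by rewrite mulr_ge0 ?ler0n ?ltW.
(* Differences of counts are integers, so the bound [e * d] may be rounded down. *)
pose k := Num.truncn (e * d%:R).
have ke : k%:R / d%:R <= e by rewrite ler_pdivrMr // /k -truncn_ge_nat.
have count_le (s t : d.-tuple R) :
    (forall y, cdf d (poly_of_roots s) y - cdf d (poly_of_roots t) y <= e) ->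
    cdf d (boxtimes d (poly_of_roots s) (poly_of_roots rho)) x -
    cdf d (boxtimes d (poly_of_roots t) (poly_of_roots rho)) x <= e.
  move=> h; rewrite lerBlDl; apply: le_trans (lerD (lexx _) ke).
  apply: cdf_boxtimes_le_shift; rewrite ?size_tuple // => y.
  rewrite -leq_subLR truncn_ge_nat //.
  have := h y; rewrite !cdf_poly_of_roots -mulrBl ler_pdivrMr //.
  (* When [t] has the larger count, the truncated difference is 0. *)
  have [ts|/ltnW/eqP ->] := leqP (count (<=%R^~ y) t) (count (<=%R^~ y) s); last by [].
  by rewrite natrB.
rewrite ler_norml lerNl opprB; apply/andP; split; apply: count_le => y.
  by have := he y; rewrite distrC ler_norml => /andP[].
by have := he y; rewrite ler_norml => /andP[].
Qed.
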